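(* Let $a>0$ and $b\in\mathbb{R}$ be such that $$a\ge 2b\ge 0\qquad\text{or}\qquad a\ge -nb\ge 0,$$ and let $\Lambda_{a,b}\subseteq\mathbb{R}^n$ be the lattice generated by an $(a,b)$-equiangular basis of $\mathbb{R}^n$. Then, for every $1\le j\le n$, we have $$\rho_j(B_n,\Lambda_{a,b})\ge\frac12\sqrt{\frac{(a-b)(a+b(n-j))}{a+b(n-j-1)}}$$ and $$\rho_j(B_n,\Lambda_{a,b})\cdot\rho_{n-j+1}\big((B_n)_c^\star,\Lambda_{a,b}^\star\big)\ge\frac12.$$ Moreover, if $n\ge2$ and $b\ne0$, then $$\rho_{n-1}(B_n,\Lambda_{a,b})<\rho_n(B_n,\Lambda_{a,b}).$$
   Context: A basis $\{v_1,\ldots,v_n\}$ of $\mathbb{R}^n$ is $(a,b)$-equiangular if $\langle v_k,v_k\rangle=a$ for all $k$ and $\langle v_k,v_\ell\rangle=b$ for all $k\ne\ell$. $B_n=\{x\in\mathbb{R}^n:\|x\|\le1\}$ is the Euclidean unit ball. (The lattice $\Lambda_{a,b}$ is determined up to orthogonal transformations, which leave $B_n$ invariant.) A convex body in $\mathbb{R}^n$ is a compact convex set with non-empty interior. $K_c=K-K=\{x-y:x,y\in K\}$ is the difference body; in particular $(B_n)_c=2B_n$. Polarity: $M^\star=\{y\in\mathbb{R}^n:\langle x,y\rangle\le 1\ \forall x\in M\}$ for a convex body $M$ (so $(B_n)_c^\star$ is the polar of $(B_n)_c$), and $\Lambda^\star=\{u\in\mathbb{R}^n:\langle w,u\rangle\in\mathbb{Z}\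 \forall w\in\Lambda\}$ for a lattice $\Lambda$. Packing minima of a convex body $K$ and an $n$-dimensional lattice $\Lambda$: for $1\le i\le n$, $\rho_i(K,\Lambda)=\inf\{\rho>0:(\rho K_c+L)\cap\Lambda\neq L\cap\Lambda\text{ for all }(n-i)\text{-dimensional linear subspaces }L\subseteq\mathbb{R}^n\}$. Equivalently, $\rho_i(K,\Lambda)=\max\lambda_1(K_c|L^\perp,\Lambda|L^\perp)$, the maximum over all $(n-i)$-dimensional linear lattice planes $L$ of $\Lambda$ (linear subspaces $L$ with $\dim L=\dim(L\cap\Lambda)=n-i$), where $\cdot|L^\perp$ is orthogonal projection onto $L^\perp$ and, for an origin-symmetric convex body $M$ and a lattice $\Gamma$ in the same Euclidean space, $\lambda_1(M,\Gamma)=\min\{\lambda>0:\lambda M\cap\Gamma\ne\{0\}\}$. *)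

(* Defs.v *)
From mathcomp Require Export all_boot all_order all_algebra.
From mathcomp Require Export all_classical all_reals.

Set Implicit Arguments.
Unset Strict Implicit.
Unset Printing Implicit Defensive.

Import Order.TTheory GRing.Theory Num.Theory.
Local Open Scope classical_set_scope.
Local Open Scope ring_scope.

(* The library's own norm on 'rV[R]_n is the sup norm, and [dotmx] lives over
   algebraically closed fields, so the Euclidean structure is spelled out. *)
Definition dot (R : realType) (n : nat) (x y : 'rV[R]_n) : R :=
  \sum_(i < n) x 0 i * y 0 i.

Definition enorm (R : realType) (n : nat) (x : 'rV[R]_n) : R :=
  Num.sqrt (dot x x).

Definition unit_ball (R : realType) (n : nat) : set 'rV[R]_n :=
  [set x | enorm x <= 1].

Definition minkowski_sum (R : realType) (n : nat) (A B : set 'rV[R]_n) :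
    set 'rV[R]_n :=
  [set x + y | x in A & y in B].

Definition dilate (R : realType) (n : nat) (r : R) (A : set 'rV[R]_n) :
    set 'rV[R]_n :=
  [set r *: x | x in A].

Definition difference_body (R : realType) (n : nat) (K : set 'rV[R]_n) :
    set 'rV[R]_n :=
  [set x - y | x in K & y in K].

Definition polar (R : realType) (n : nat) (M : set 'rV[R]_n) : set 'rV[R]_n :=
  [set y | forall x, M x -> dot x y <= 1].

Definition dual_lattice (R : realType) (n : nat) (L : set 'rV[R]_n) :
    set 'rV[R]_n :=
  [set u | forall w, L w -> dot w u \is a Num.int].

Definition lattice_of (R : realType) (n : nat) (v : n.-tuple 'rV[R]_n) :
    set 'rV[R]_n :=
  [set x | exists c : 'I_n -> int, x = \sum_(k < n) tnth v k *~ c k].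

Definition equiangular_basis (R : realType) (n : nat) (a b : R)
    (v : n.-tuple 'rV[R]_n) : Prop :=
  [/\ basis_of {: 'rV[R]_n} v,
      forall k, dot (tnth v k) (tnth v k) = a
    & forall k l, k != l -> dot (tnth v k) (tnth v l) = b].

(* Meaningful for 1 <= i <= n only: there the set below is nonempty and bounded
   below by 0 when K is a convex body and Lam an n-dimensional lattice, so that
   [inf] is the genuine infimum; also (n - i)%N is then not truncated. *)
Definition packing_minimum (R : realType) (n : nat) (i : nat)
    (K Lam : set 'rV[R]_n) : R :=
  inf [set rho : R | 0 < rho /\
    forall L : {vspace 'rV[R]_n}, \dim L = (n - i)%N ->
      minkowski_sum (dilate rho (difference_body K)) [set` L] `&` Lam
        <> [set` L] `&` Lam].

(* Main.v *)
(* Let [v] be an (a,b)-equiangular basis and [w] its dual basis, which is again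
   equiangular.  The assumptions say that 2b <= a and 0 <= a + nb, and these two
   inequalities together are invariant under passing from [v] to [w].

   If x lies in the lattice generated by [w] but not in the span L of all but
   the first N vectors of [w], then the products of x with the first N vectors
   of [v] are integers, not all zero, and are unchanged modulo L.  The distance
   from x to L is therefore at least the value of an explicit quadratic form
   alpha sum c_i^2 + beta (sum c_i)^2 at a nonzero integer vector, which under
   the assumptions is minimal at a unit vector.  This bounds the N-th packing
   minimum from below.  Applying it to the dual pair in both orders gives bounds
   for the lattice and its dual which are reciprocal, hence the first two claims.

   For the strict inequality, every line L has a basis vector outside it whose
   squared distance to L is at most a - eps, with eps independent of L: either L
   contains no v_k, and some v_k has a non-negligible component along L, or
   L = <v_k>, and any other v_l has squared distance a - b^2/a. *)
Require Import Defs.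
From mathcomp Require Import zify ring lra.
Import Order.TTheory GRing.Theory Num.Theory.
Local Open Scope classical_set_scope.
Local Open Scope ring_scope.

Set Implicit Arguments.
Unset Strict Implicit.
Unset Printing Implicit Defensive.

(** * Euclidean inner product and norm *)

Section Dot.
Variables (R : realType) (n : nat).
Implicit Types (x y z : 'rV[R]_n) (r : R).

Lemma dotC x y : dot x y = dot y x.
Proof. by apply: eq_bigr => i _; rewrite mulrC. Qed.

Lemma dotDl x y z : dot (x + y) z = dot x z + dot y z.
Proof. by rewrite /dot -big_split; apply: eq_bigr => i _; rewrite !mxE mulrDl. Qed.

Lemma dotZl r x y : dot (r *: x) y = r * dot x y.
Proof. by rewrite /dot mulr_sumr; apply: eq_bigr => i _; rewrite !mxE mulrA. Qed.

Lemma dotNl x y : dot (- x) y = - dot x y.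
Proof. by rewrite -scaleN1r dotZl mulN1r. Qed.

Lemma dotBl x y z : dot (x - y) z = dot x z - dot y z.
Proof. by rewrite dotDl dotNl. Qed.

Lemma dot0l x : dot 0 x = 0.
Proof. by rewrite -(scale0r x) dotZl mul0r. Qed.

Lemma dotDr x y z : dot z (x + y) = dot z x + dot z y.
Proof. by rewrite dotC dotDl !(dotC _ z). Qed.

Lemma dotZr r x y : dot y (r *: x) = r * dot y x.
Proof. by rewrite dotC dotZl (dotC x). Qed.

Lemma dotNr x y : dot y (- x) = - dot y x.
Proof. by rewrite dotC dotNl (dotC x). Qed.

Lemma dotBr x y z : dot z (x - y) = dot z x - dot z y.
Proof. by rewrite dotDr dotNr. Qed.

Lemma dot_suml (I : finType) (P : pred I) (F : I -> 'rV[R]_n) x :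
  dot (\sum_(i | P i) F i) x = \sum_(i | P i) dot (F i) x.
Proof.
apply: (big_morph (fun y => dot y x)) => [y z|]; first exact: dotDl.
exact: dot0l.
Qed.

Lemma dot_sumr (I : finType) (P : pred I) (F : I -> 'rV[R]_n) x :
  dot x (\sum_(i | P i) F i) = \sum_(i | P i) dot x (F i).
Proof. by rewrite dotC dot_suml; apply: eq_bigr => i _; rewrite dotC. Qed.

Lemma dot_ge0 x : 0 <= dot x x.
Proof. by apply: sumr_ge0 => i _; rewrite -expr2 sqr_ge0. Qed.

Lemma dot_eq0 x : (dot x x == 0) = (x == 0).
Proof.
apply/eqP/eqP => [|->]; last exact: dot0l.
move/eqP; rewrite psumr_eq0 => [/allP h|i _]; last by rewrite -expr2 sqr_ge0.
apply/rowP => i; rewrite mxE; apply/eqP.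
by have := h i (mem_index_enum i); rewrite /= -expr2 sqrf_eq0.
Qed.

Lemma dot_gt0 x : (0 < dot x x) = (x != 0).
Proof. by rewrite lt_def dot_eq0 dot_ge0 andbT. Qed.

(** The squared length of [dot y y *: x - dot x y *: y] is [dot y y] times the difference of the two
    sides. *)
Lemma cauchy_schwarz x y : dot x y ^+ 2 <= dot x x * dot y y.
Proof.
have [->|y0] := eqVneq y 0; first by rewrite (dotC x) !dot0l expr0n mulr0.
have yy : 0 < dot y y by rewrite dot_gt0.
rewrite -subr_ge0 -(pmulr_rge0 _ yy).
have := dot_ge0 (dot y y *: x - dot x y *: y).
rewrite !(dotBl, dotBr, dotZl, dotZr) (dotC y x).
by congr (0 <= _); ring.
Qed.

Lemma enorm_ge0 x : 0 <= enorm x.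
Proof. exact: sqrtr_ge0. Qed.

Lemma sqr_enorm x : enorm x ^+ 2 = dot x x.
Proof. by rewrite sqr_sqrtr ?dot_ge0. Qed.

Lemma enorm_le r x : 0 <= r -> (enorm x <= r) = (dot x x <= r ^+ 2).
Proof. by move=> r0; rewrite -sqr_enorm ler_sqr ?nnegrE ?enorm_ge0. Qed.

Lemma enormZ r x : 0 <= r -> enorm (r *: x) = r * enorm x.
Proof.
move=> r0; rewrite /enorm dotZl dotZr mulrA sqrtrM ?mulr_ge0 //.
by rewrite -expr2 sqrtr_sqr ger0_norm.
Qed.

Lemma enormN x : enorm (- x) = enorm x.
Proof. by rewrite /enorm dotNl dotNr opprK. Qed.

Lemma enormD x y : enorm (x + y) <= enorm x + enorm y.
Proof.
rewrite enorm_le ?addr_ge0 ?enorm_ge0 // sqrrD !sqr_enorm dotDl !dotDr (dotC y x).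
have: dot x y <= enorm x * enorm y.
  apply: le_trans (ler_norm _) _.
  rewrite -ler_sqr ?nnegrE ?mulr_ge0 ?enorm_ge0 //.
  by rewrite real_normK ?num_real // exprMn !sqr_enorm cauchy_schwarz.
lra.
Qed.

End Dot.

(** * Difference bodies and polars of centred balls *)

Section Bodies.
Variables (R : realType) (n : nat).

Definition ball (r : R) : set 'rV[R]_n := [set x | enorm x <= r].

Lemma difference_body_ball (r : R) :
  difference_body (ball r) = ball (2 * r).
Proof.
apply/seteqP; split => [_ [x hx [y hy <-]]|x hx] /=.
  rewrite /ball /=; apply: le_trans (enormD _ _) _; rewrite enormN.
  by move: hx hy; rewrite /ball /=; lra.
exists (2^-1 *: x); first by move: hx; rewrite /ball /= enormZ //; lra.
exists (- (2^-1 *: x)).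
  by move: hx; rewrite /ball /= enormN enormZ //; lra.
by rewrite opprK -scalerDl -[RHS]scale1r; congr (_ *: _); lra.
Qed.

Lemma polar_ball (r : R) : 0 < r -> polar (ball r) = ball r^-1.
Proof.
move=> r0; apply/seteqP; split => y hy.
  rewrite /ball /=; have [->|y0] := eqVneq (enorm y) 0; first by rewrite invr_ge0 ltW.
  have ny : 0 < enorm y by rewrite lt_def y0 enorm_ge0.
  (* Test [y] against its own multiple of norm [r]. *)
  have := hy ((r / enorm y) *: y).
  rewrite /ball /= enormZ ?divr_ge0 ?enorm_ge0 // ?(ltW r0) // divfK // lexx => /(_ isT).
  rewrite dotZl -sqr_enorm expr2 mulrA divfK // -ler_pdivlMl ?mulr1 //.
move=> x hx; apply: le_trans (ler_norm _) _.
rewrite -ler_sqr ?nnegrE // real_normK ?num_real //.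
apply: le_trans (cauchy_schwarz _ _) _; rewrite -!sqr_enorm -exprMn.
rewrite ler_sqr ?nnegrE ?mulr_ge0 ?enorm_ge0 //.
by rewrite -(mulfV (lt0r_neq0 r0)); apply: ler_pM => //; exact: enorm_ge0.
Qed.

End Bodies.

(** * Quadratic forms at integer points *)

Section Sums.
Variables (R : realType) (I : finType).
Implicit Types (P : pred I) (c : I -> R).

(** With N the number of terms, the sum of the (N c_i - T)^2 equals N (N S - T^2). *)
Lemma sqr_sum_le P c :
  (\sum_(i | P i) c i) ^+ 2 <= #|P|%:R * \sum_(i | P i) c i ^+ 2.
Proof.
set T := \sum_(i | P i) c i; set S := \sum_(i | P i) c i ^+ 2.
have [/eqP P0|] := posnP #|P|.
  have {}P0 : P =1 pred0 by apply/pred0P.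
  by rewrite /T /S !big_pred0 // expr0n mulr0.
rewrite -(ltr0n R) => N0.
rewrite -subr_ge0 -(pmulr_rge0 _ N0).
have : 0 <= \sum_(i | P i) (#|P|%:R * c i - T) ^+ 2.
  by apply: sumr_ge0 => i _; exact: sqr_ge0.
congr (0 <= _).
rewrite (eq_bigr (fun i => #|P|%:R ^+ 2 * c i ^+ 2
  - (2 * #|P|%:R * T) * c i + T ^+ 2)); last by move=> i _; ring.
rewrite big_split sumrB /= -!mulr_sumr sumr_const -/S -/T -(mulr_natl T).
ring.
Qed.

Lemma int_norm_le_sqr (x : R) : x \is a Num.int -> `|x| <= x ^+ 2.
Proof.
move=> xi; have [->|x0] := eqVneq x 0; first by rewrite normr0 expr0n.
have := norm_intr_ge1 xi x0; rewrite -(real_normK (num_real x)); nra.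
Qed.

Lemma int_sqr_ge1 (x : R) : x \is a Num.int -> x != 0 -> 1 <= x ^+ 2.
Proof. by move=> xi x0; apply: le_trans (int_norm_le_sqr xi); exact: norm_intr_ge1. Qed.

Lemma int_norm_sum_le P c : (forall i, P i -> c i \is a Num.int) ->
  `|\sum_(i | P i) c i| <= \sum_(i | P i) c i ^+ 2.
Proof.
move=> ci; apply: le_trans (ler_norm_sum _ _ _) _.
by apply: ler_sum => i Pi; exact/int_norm_le_sqr/ci.
Qed.

(* The form is linear in [beta], so it suffices to treat the two extreme values
   of [beta]; they are the two inequalities below. *)
Lemma int_form_ge P c (alpha beta : R) :
  (forall i, P i -> c i \is a Num.int) -> (exists2 i, P i & c i != 0) ->
  beta <= alpha -> - ((#|P|%:R + 1) * beta) <= alpha ->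
  alpha + beta <= alpha * (\sum_(i | P i) c i ^+ 2)
                  + beta * (\sum_(i | P i) c i) ^+ 2.
Proof.
move=> ci [k Pk ck0] hb hN.
set T := \sum_(i | P i) c i; set S := \sum_(i | P i) c i ^+ 2.
have N0 : 0 <= #|P|%:R :> R by [].
have NS : T ^+ 2 <= #|P|%:R * S by exact: sqr_sum_le.
have TS : `|T| <= S by exact: int_norm_sum_le.
have T2 : T ^+ 2 = `|T| ^+ 2 by rewrite real_normK ?num_real.
have nT := normr_ge0 T.
have ck1 := int_sqr_ge1 (ci _ Pk) ck0.
have SD : S = c k ^+ 2 + \sum_(i | P i && (i != k)) c i ^+ 2 by rewrite /S (bigD1 k).
have TD : T = c k + \sum_(i | P i && (i != k)) c i by rewrite /T (bigD1 k).
have S'0 : 0 <= \sum_(i | P i && (i != k)) c i ^+ 2.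
  by apply: sumr_ge0 => i _; exact: sqr_ge0.
(* The case [beta = alpha]. If [T = 0], the other terms sum to [- c k] and so add at least
   [|c k| >= 1] to [S]; otherwise [S] and [T ^+ 2] are both at least 1. *)
have upper : 2 <= S + T ^+ 2.
  have [T0|Tn0] := eqVneq T 0.
    have ckE : `|c k| = `|\sum_(i | P i && (i != k)) c i|.
      by move: TD; rewrite T0 => /esym/eqP; rewrite addr_eq0 => /eqP ->; rewrite normrN.
    have : `|\sum_(i | P i && (i != k)) c i| <= \sum_(i | P i && (i != k)) c i ^+ 2.
      by apply: int_norm_sum_le => i /andP[Pi _]; exact: ci.
    have := norm_intr_ge1 (ci _ Pk) ck0.
    rewrite -ckE T0 expr0n /=; lra.
  have : 1 <= T ^+ 2 by apply: int_sqr_ge1 => //; exact: rpred_sum.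
  lra.
(* The case [- (N + 1) * beta = alpha], where N is the number of terms. Use [T ^+ 2 <= S ^+ 2] when
   [S <= N], and [T ^+ 2 <= N * S] when [S > N]. *)
have lower : T ^+ 2 - 1 <= (#|P|%:R + 1) * (S - 1).
  have [SN|NS'] := leP S #|P|%:R; nra.
have [b0|b0] := leP 0 beta; nra.
Qed.

End Sums.

(** * Lengths of vectors having integral products with an equiangular system *)

Section Equiangular.
Variables (R : realType) (n : nat) (I : finType).
Implicit Types (P : pred I) (u : I -> 'rV[R]_n).

(** The Gram matrix is (A - B) I + B J, with J the all-ones matrix. *)
Lemma dot_equiangular_sum P u (A B : R) (x : I -> R) k :
  (forall i, P i -> dot (u i) (u i) = A) ->
  (forall i j, P i -> P j -> i != j -> dot (u i) (u j) = B) -> P k ->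
  dot (\sum_(i | P i) x i *: u i) (u k) = (A - B) * x k + B * \sum_(i | P i) x i.
Proof.
move=> uA uB Pk; rewrite dot_suml (bigD1 k) //= [in RHS](bigD1 k) //= dotZl uA //.
rewrite (eq_bigr (fun i => B * x i)) => [|i /andP[Pi ik]]; last first.
  by rewrite dotZl uB // mulrC.
by rewrite -mulr_sumr; ring.
Qed.

(* A vector with prescribed integral products [dot z (u i)] is at least as long
   as its projection [t] to the span of the [u i]; the coefficients of [t] come
   from the Sherman-Morrison inverse of the Gram matrix. *)
Lemma equiangular_dual_norm_ge P u (A B : R) z :
  (forall i, P i -> dot (u i) (u i) = A) ->
  (forall i j, P i -> P j -> i != j -> dot (u i) (u j) = B) ->
  0 < A - B -> 0 < A + (#|P|%:R - 1) * B -> 2 * B <= A -> 0 <= A + #|P|%:R * B ->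
  (forall i, P i -> dot z (u i) \is a Num.int) ->
  (exists2 i, P i & dot z (u i) != 0) ->
  (A + (#|P|%:R - 2) * B) / ((A - B) * (A + (#|P|%:R - 1) * B)) <= dot z z.
Proof.
move=> uA uB p0 q0 hA hN zi zn0.
set c := fun i => dot z (u i).
set S := \sum_(i | P i) c i ^+ 2; set T := \sum_(i | P i) c i.
set q := A + (#|P|%:R - 1) * B in q0 *; set p := A - B in p0 *.
have pn : p != 0 by rewrite gt_eqF.
have qn : q != 0 by rewrite gt_eqF.
(* The solution of p x_k + B (sum of the x_i) = c_k; summing over k shows that the x_i add up to
   [T / q]. *)
pose x i := (c i - B * T / q) / p.
pose t := \sum_(i | P i) x i *: u i.
have xT : \sum_(i | P i) x i = T / q.
  rewrite /x -mulr_suml sumrB sumr_const -/T -(mulr_natl _ #|P|).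
  rewrite -[RHS](mulfK pn); congr (_ / p).
  have -> : p = q - #|P|%:R * B by rewrite /p /q; ring.
  by field.
have tu k : P k -> dot t (u k) = c k.
  move=> Pk; rewrite (dot_equiangular_sum _ uA uB Pk) xT /x -/p.
  by field; rewrite pn qn.
have zt : dot z t = (S - B * T ^+ 2 / q) / p.
  rewrite /t dot_sumr (eq_bigr (fun k => (c k ^+ 2 - B * T / q * c k) / p)).
    by rewrite -mulr_suml sumrB -mulr_sumr -/S -/T; congr (_ / p); ring.
  by move=> k _; rewrite dotZr -/(c k) /x; ring.
have tt : dot t t = dot z t.
  rewrite {2}/t !dot_sumr; apply: eq_bigr => k Pk.
  by rewrite !dotZr tu.
have : dot z t <= dot z z.
  have := dot_ge0 (z - t); rewrite dotBl !dotBr (dotC t z) tt; lra.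
apply: le_trans; rewrite zt.
(* Both sides take the shape of [int_form_ge] with [alpha = p^-1] and [beta = - B / (p * q)]; its
   two conditions on [beta] then become [hN] and [hA]. *)
have -> : (A + (#|P|%:R - 2) * B) / (p * q) = p^-1 + - B / (p * q).
  have -> : A + (#|P|%:R - 2) * B = q - B by rewrite /q; ring.
  by field; rewrite pn qn.
have -> : (S - B * T ^+ 2 / q) / p = p^-1 * S + - B / (p * q) * T ^+ 2.
  by field; rewrite pn qn.
apply: int_form_ge => //.
  rewrite ler_pdivrMr ?mulr_gt0 // mulrA mulVf // mul1r /q; lra.
rewrite mulrA -mulNr ler_pdivrMr ?mulr_gt0 // mulrA mulVf // mul1r /q; lra.
Qed.

End Equiangular.

(** * Biorthogonal bases and coordinate subspaces *)

Section DualBases.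
Variables (R : realType) (n : nat).
Implicit Types (v w : n.-tuple 'rV[R]_n).

Definition biorthogonal v w :=
  forall k l, dot (tnth v k) (tnth w l) = (k == l)%:R.

Lemma biorthogonal_sym v w : biorthogonal v w -> biorthogonal w v.
Proof. by move=> vw k l; rewrite dotC vw eq_sym. Qed.

Lemma biorthogonal_basis v w : biorthogonal v w -> basis_of {: 'rV[R]_n} v.
Proof.
move=> vw; rewrite basisEfree subvf dimvf dim_matrix mul1r size_tuple leqnn !andbT.
apply/freeP => k k0 i.
have := congr1 (fun x => dot x (tnth w i)) k0.
rewrite dot0l dot_suml (bigD1 i) //= dotZl -tnth_nth vw eqxx mulr1 big1 ?addr0 //.
by move=> j ji; rewrite dotZl -tnth_nth vw (negPf ji) mulr0.
Qed.

(** The difference of the two sides is orthogonal to the basis [v], hence to itself. *)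
Lemma biorthogonal_expansion v w x : biorthogonal v w ->
  x = \sum_(k < n) dot x (tnth v k) *: tnth w k.
Proof.
move=> vw; have vb := biorthogonal_basis vw.
set y := \sum_(_ < _) _.
have orth k : dot (x - y) (tnth v k) = 0.
  rewrite dotBl /y dot_suml (bigD1 k) //= dotZl (biorthogonal_sym vw) eqxx mulr1.
  rewrite big1 ?addr0 ?subrr // => j jk.
  by rewrite dotZl (biorthogonal_sym vw) (negPf jk) mulr0.
apply/eqP; rewrite -subr_eq0 -dot_eq0.
rewrite {2}(coord_basis vb (memvf (x - y))) dot_sumr big1 // => k _.
by rewrite dotZr -tnth_nth orth mulr0.
Qed.

Lemma dim_span_drop v m : basis_of {: 'rV[R]_n} v -> (m <= n)%N ->
  \dim <<drop m v>> = (n - m)%N.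
Proof.
move=> /basis_free vf mn; suff /eqP -> : free (drop m v) by rewrite size_drop size_tuple.
by apply: (@catr_free _ _ (take m v)); rewrite cat_take_drop.
Qed.

Lemma span_drop_orth v w m (k : 'I_n) x : biorthogonal v w -> (k < m)%N ->
  x \in <<drop m w>>%VS -> dot x (tnth v k) = 0.
Proof.
move=> vw km xw; rewrite (coord_span (X := drop_tuple m w) xw) dot_suml.
apply: big1 => i _; rewrite dotZl nth_drop.
have mi : (m + i < n)%N by have := ltn_ord i; lia.
rewrite -[(m + i)%N]/(val (Ordinal mi)) -tnth_nth (biorthogonal_sym vw).
by rewrite -val_eqE /= gtn_eqF ?mulr0 // ltn_addr.
Qed.


End DualBases.

(** * Packing minima of bodies whose difference body is a ball *)

Section PackingMinimum.
Variables (R : realType) (n : nat).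
Implicit Types (K Lam : set 'rV[R]_n) (v w : n.-tuple 'rV[R]_n).

(** The set under [inf] in [packing_minimum], repeated verbatim so that the two agree by
    conversion. *)
Definition packing_set (i : nat) K Lam : set R :=
  [set rho : R | 0 < rho /\
    forall L : {vspace 'rV[R]_n}, \dim L = (n - i)%N ->
      minkowski_sum (dilate rho (difference_body K)) [set` L] `&` Lam
        <> [set` L] `&` Lam].

(** The ball contains 0, so the thickened subspace always contains [L]; the two intersections differ
    exactly when a lattice vector outside [L] lies within [rho * delta] of [L]. *)
Lemma packing_set_ball (i : nat) K Lam (delta rho : R) :
  difference_body K = ball delta -> 0 <= delta ->
  packing_set i K Lam rho <->
  0 < rho /\ forall L : {vspace 'rV[R]_n}, \dim L = (n - i)%N ->
    exists x y, [/\ Lam x, x \notin L, y \in L & enorm (x - y) <= rho * delta].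
Proof.
move=> KB d0; rewrite /packing_set KB /=.
split=> -[rho0 h]; split=> // L dL; last first.
  have [x [y [xLam xL yL xy]]] := h _ dL.
  move=> E; suff : ([set` L] `&` Lam) x by move=> [/=]; rewrite (negPf xL).
  rewrite -E; split=> //; exists (x - y); last by exists y => //; rewrite subrK.
  exists (rho^-1 *: (x - y)); last by rewrite scalerA divff ?scale1r ?gt_eqF.
  by rewrite /ball /= enormZ ?invr_ge0 ?(ltW rho0) // ler_pdivrMl.
apply: contrapT => no; apply: (h _ dL); apply/seteqP; split=> [x|x] /= [xL xLam].
  split=> //; apply: contrapT => xnL; apply: no.
  move: xL => [_ [z zB <-] [y yL xE]]; exists x, y; split=> //; first exact/negP.
  by rewrite -xE addrK enormZ ?(ltW rho0) // ler_pM2l.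
split=> //; exists 0; last by exists x => //; rewrite add0r.
by exists 0; rewrite ?scaler0 // /ball /= /enorm dot0l sqrtr0.
Qed.

Lemma exists_basis_notin v (L : {vspace 'rV[R]_n}) :
  basis_of {: 'rV[R]_n} v -> (\dim L < n)%N -> exists k, tnth v k \notin L.
Proof.
move=> vb dL; apply: contrapT => no.
have : ({: 'rV[R]_n} <= L)%VS.
  rewrite -(span_basis vb); apply/span_subvP => x /tnthP [k ->].
  by apply: contrapT => /negP kL; apply: no; exists k.
by move/dimvS; rewrite dimvf dim_matrix mul1r leqNgt dL.
Qed.

(** Makes the infimum genuine. Some basis vector lies outside [L], and its distance to 0 is at most
    the sum of all the norms; the extra 1 makes positivity immediate. *)
Lemma packing_set_nonempty (i : nat) K Lam (delta : R) v :
  difference_body K = ball delta -> 0 < delta ->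
  basis_of {: 'rV[R]_n} v -> (forall k, Lam (tnth v k)) -> (0 < i <= n)%N ->
  (packing_set i K Lam !=set0)%classic.
Proof.
move=> KB d0 vb vLam /andP[i0 iN].
have s0 : 0 <= \sum_(k < n) enorm (tnth v k) by apply: sumr_ge0 => k _; exact: enorm_ge0.
exists ((1 + \sum_(k < n) enorm (tnth v k)) / delta).
apply/(packing_set_ball _ _ _ KB (ltW d0)); split=> [|L dL].
  by rewrite divr_gt0 // ltr_pwDl.
have [|k kL] := exists_basis_notin (L := L) vb; first by rewrite dL; lia.
exists (tnth v k), 0; split=> //; first exact: mem0v.
rewrite subr0 divfK ?gt_eqF // (bigD1 k) //= addrCA lerDl addr_ge0 //.
by apply: sumr_ge0 => j _; exact: enorm_ge0.
Qed.

(* The minimum is bounded below on the coordinate subspace spanned by all but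
   the first [N] vectors of [w]. *)
Lemma packing_minimum_ge (N : nat) K Lam (delta A B : R) v w :
  difference_body K = ball delta -> 0 < delta -> biorthogonal v w ->
  (forall k, dot (tnth v k) (tnth v k) = A) ->
  (forall k l, k != l -> dot (tnth v k) (tnth v l) = B) ->
  0 < A - B -> 0 < A + (N%:R - 1) * B -> 2 * B <= A -> 0 <= A + N%:R * B ->
  (forall x, Lam x -> forall k, dot x (tnth v k) \is a Num.int) ->
  (forall k, Lam (tnth w k)) -> (0 < N <= n)%N ->
  Num.sqrt ((A + (N%:R - 2) * B) / ((A - B) * (A + (N%:R - 1) * B))) / delta
    <= packing_minimum N K Lam.
Proof.
move=> KB d0 vw vA vB p0 q0 hA hN Lami wLam N0n; have /andP[N0 Nn] := N0n.
have wv := biorthogonal_sym vw.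
apply: lb_le_inf.
  exact: (packing_set_nonempty KB d0 (biorthogonal_basis wv) wLam).
move=> rho /(packing_set_ball _ _ _ KB (ltW d0)) [rho0 /(_ <<drop N w>>%VS)].
case=> [|x [y [xLam xL yL xy]]].
  by rewrite dim_span_drop ?(biorthogonal_basis wv).
rewrite ler_pdivrMr //; apply: le_trans xy.
rewrite /enorm ler_wsqrtr //.
pose P := [pred k : 'I_n | (k < N)%N].
have cP : #|P| = N.
  by rewrite -sum1_card /= (big_ord_narrow Nn) sum1_card card_ord.
have yk k : P k -> dot (x - y) (tnth v k) = dot x (tnth v k).
  by move=> Pk; rewrite dotBl (span_drop_orth vw Pk yL) subr0.
rewrite -{1 2}cP; apply: (@equiangular_dual_norm_ge _ _ _ P (tnth v)); rewrite ?cP //.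
- by move=> k l _ _; exact: vB.
- by move=> k Pk; rewrite yk //; exact: Lami.
(* If the first [N] products all vanished, the expansion of [x] in [w] would involve only the
   vectors spanning the subspace. *)
apply: contrapT => no; move/negP: xL; apply.
rewrite (biorthogonal_expansion x vw) memv_suml // => k _.
have [kN|Nk] := ltnP k N.
  rewrite -yk //; have [->|k0] := eqVneq (dot (x - y) (tnth v k)) 0.
    by rewrite scale0r mem0v.
  by case: no; exists k.
rewrite memvZ // memv_span // (tnth_nth 0) -(subnKC Nk) -nth_drop mem_nth //.
by rewrite size_drop size_tuple ltn_sub2r // (leq_ltn_trans Nk).
Qed.

End PackingMinimum.

(** * The dual of an equiangular basis *)

Section EquiangularBasis.
Variables (R : realType) (n : nat) (a b : R) (v : n.-tuple 'rV[R]_n).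

Let p := a - b.
Let q := a + (n%:R - 1) * b.

(** The coefficients are the rows of the inverse Gram matrix p^-1 (I - (b / q) J), J being the
    all-ones matrix. *)
Definition equiangular_dual : n.-tuple 'rV[R]_n :=
  [tuple p^-1 *: (tnth v k - (b / q) *: \sum_(l < n) tnth v l) | k < n].

Hypothesis va : forall k, dot (tnth v k) (tnth v k) = a.
Hypothesis vb : forall k l, k != l -> dot (tnth v k) (tnth v l) = b.
Hypotheses (p_gt0 : 0 < p) (q_gt0 : 0 < q).

Let p_neq0 : p != 0. Proof. by rewrite gt_eqF. Qed.
Let q_neq0 : q != 0. Proof. by rewrite gt_eqF. Qed.

Lemma equiangular_dualP : biorthogonal v equiangular_dual.
Proof.
apply: biorthogonal_sym => k l; rewrite tnth_mktuple dotZl dotBl dotZl.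
have -> : dot (\sum_(i < n) tnth v i) (tnth v l) = q.
  rewrite (eq_bigr (fun i => 1 *: tnth v i)) => [|i _]; last by rewrite scale1r.
  rewrite (@dot_equiangular_sum _ _ _ xpredT (tnth v) a b) //; last first.
    by move=> i j _ _; exact: vb.
  by rewrite sumr_const card_ord /q -(mulr_natl _ n); ring.
have -> : dot (tnth v k) (tnth v l) = p * (k == l)%:R + b.
  by have [->|kl] := eqVneq k l; rewrite /= ?va ?(vb kl) /p; ring.
by rewrite divfK // addrK mulKf.
Qed.

Lemma dot_equiangular_dual k l :
  dot (tnth equiangular_dual k) (tnth equiangular_dual l)
    = p^-1 * ((k == l)%:R - b / q).
Proof.
rewrite {1}tnth_mktuple dotZl dotBl dotZl equiangular_dualP dot_suml (bigD1 l) //=.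
rewrite equiangular_dualP eqxx big1 ?addr0 ?mulr1 // => i il.
by rewrite equiangular_dualP (negPf il).
Qed.

End EquiangularBasis.

(** * Strict upper bound for the last but one packing minimum *)

Section Strict.
Variables (R : realType) (n : nat).

(** Quantifies that no nonzero [u] is nearly orthogonal to every vector of [v]. Cauchy-Schwarz is
    applied to the coordinate vectors of [u] in both bases, then to each [dot u (tnth w k)]. *)
Lemma dot_le_sum_coord (v w : n.-tuple 'rV[R]_n) (u : 'rV[R]_n) :
  biorthogonal v w ->
  dot u u <= (\sum_(k < n) dot u (tnth v k) ^+ 2)
             * \sum_(k < n) dot (tnth w k) (tnth w k).
Proof.
move=> vw; have [->|u0] := eqVneq u 0.
  by rewrite dot0l mulr_ge0 // sumr_ge0 // => k _; rewrite ?sqr_ge0 ?dot_ge0.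
have uu : 0 < dot u u by rewrite dot_gt0.
set y := \row_k dot u (tnth v k); set z := \row_k dot u (tnth w k).
have yz : dot u u = dot y z.
  rewrite {2}(biorthogonal_expansion u vw) dot_sumr; apply: eq_bigr => k _.
  by rewrite dotZr !mxE.
have yy : dot y y = \sum_(k < n) dot u (tnth v k) ^+ 2.
  by apply: eq_bigr => k _; rewrite mxE expr2.
have zz : dot z z <= dot u u * \sum_(k < n) dot (tnth w k) (tnth w k).
  rewrite mulr_sumr; apply: ler_sum => k _.
  by rewrite mxE -expr2 cauchy_schwarz.
rewrite -yy -(ler_pM2l uu) -expr2 {1}yz.
rewrite mulrCA; apply: le_trans (cauchy_schwarz y z) _.
by rewrite ler_wpM2l ?dot_ge0.
Qed.

Lemma packing_minimum_pred_lt (a b : R) (v w : n.-tuple 'rV[R]_n)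
    (Lam K : set 'rV[R]_n) :
  difference_body K = ball 2 -> biorthogonal v w ->
  (forall k, Lam (tnth v k)) ->
  (forall k, dot (tnth v k) (tnth v k) = a) ->
  (forall k l, k != l -> dot (tnth v k) (tnth v l) = b) ->
  0 < a -> b ^+ 2 < a ^+ 2 -> b != 0 -> (2 <= n)%N ->
  packing_minimum (n - 1) K Lam < 2^-1 * Num.sqrt a.
Proof.
move=> KB vw vLam va vb a0 ba b0 n2.
set W := \sum_(k < n) dot (tnth w k) (tnth w k).
have W0 : 0 <= W by apply: sumr_ge0 => k _; exact: dot_ge0.
have nW : 0 < n%:R * W + 1 by rewrite ltr_wpDl // mulr_ge0.
have bb : 0 < b ^+ 2 by rewrite exprn_even_gt0.
(* The three terms serve, in order, a line containing no basis vector, a line spanned by one, and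
   the positivity of [a - eps]. *)
pose eps := Num.min (n%:R * W + 1)^-1 (Num.min (b ^+ 2 / a) (a / 2)).
have eps0 : 0 < eps by rewrite !lt_min invr_gt0 nW !divr_gt0.
have epsW : eps * (n%:R * W + 1) <= 1.
  by rewrite -ler_pdivlMr // mul1r ge_min lexx.
have epsb : eps * a <= b ^+ 2 by rewrite -ler_pdivlMr // !ge_min lexx !orbT.
have epsa : eps <= a / 2 by rewrite !ge_min lexx !orbT.
have ae : 0 < a - eps by lra.
apply: (@le_lt_trans _ _ (2^-1 * Num.sqrt (a - eps))); last first.
  by rewrite ltr_pM2l ?invr_gt0 ?ltr0n //; rewrite ltr_sqrt; lra.
apply: (@ge_inf _ (packing_set (n - 1) K Lam)); first by exists 0 => r [/ltW].
apply/(packing_set_ball _ _ _ KB (ler0n _ 2)).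
split=> [|L]; first by rewrite mulr_gt0 ?sqrtr_gt0 ?invr_gt0 ?ltr0n.
rewrite subKn ?(ltnW n2) // => dL.
pose u := vpick L.
have uL : u \in L by exact: memv_pick.
have u0 : u != 0 by rewrite vpick0 -dimv_eq0 dL.
have LE : L = <[u]>%VS.
  by apply/esym/eqP; rewrite eqEdim -memvE uL dL dim_vline u0.
have uu : 0 < dot u u by rewrite dot_gt0.
(* The squared distance from v_k to the line is a - (u . v_k)^2 / (u . u). *)
suff [k kL ku] : exists2 k, tnth v k \notin L & eps * dot u u <= dot u (tnth v k) ^+ 2.
  exists (tnth v k), ((dot u (tnth v k) / dot u u) *: u); split=> //.
    exact: memvZ.
  rewrite [leRHS](_ : _ = Num.sqrt (a - eps)); last by field.
  rewrite enorm_le ?sqrtr_ge0 // sqr_sqrtr ?(ltW ae) //.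
  rewrite !(dotBl, dotBr, dotZl, dotZr) va (dotC _ u).
  rewrite -(ler_pM2l uu) -subr_ge0.
  apply: le_trans (_ : 0 <= dot u (tnth v k) ^+ 2 - eps * dot u u) _.
    by rewrite subr_ge0.
  by rewrite le_eqVlt; apply/orP; left; apply/eqP; field; rewrite gt_eqF.
(* Otherwise [dot_le_sum_coord] gives u . u <= n eps W (u . u), although n eps W < 1. *)
have [k ku] : exists k, eps * dot u u <= dot u (tnth v k) ^+ 2.
  apply: contrapT => no.
  have : \sum_(k < n) dot u (tnth v k) ^+ 2 <= \sum_(k < n) eps * dot u u.
    by apply: ler_sum => k _; rewrite leNgt; apply/negP => /ltW ?; apply: no; exists k.
  rewrite sumr_const card_ord -mulr_natl => le1.
  have := dot_le_sum_coord u vw; rewrite -/W => le2.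
  have := le_trans le2 (ler_wpM2r W0 le1); nra.
have [kL|] := boolP (tnth v k \in L); last by exists k.
have [t kt] : exists t, tnth v k = t *: u by apply/vlineP; rewrite -LE.
have [l lk] : exists l : 'I_n, l != k.
  have [k0|k0] := eqVneq (val k) 0%N.
    by exists (Ordinal n2); rewrite -val_eqE /= k0.
  by exists (Ordinal (ltnW n2)); rewrite -val_eqE /= eq_sym.
have ta : t ^+ 2 * dot u u = a by rewrite -(va k) kt dotZl dotZr; ring.
have tb : t * dot u (tnth v l) = b by rewrite -(vb _ _ lk) kt dotZr (dotC _ u).
exists l.
  (* Two parallel basis vectors would give equality in Cauchy-Schwarz, that is b^2 = a^2. *)
  apply/negP; rewrite LE => /vlineP [s ls]; move: ba.
  have sa : s ^+ 2 * dot u u = a by rewrite -(va l) ls dotZl dotZr; ring.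
  have -> : b ^+ 2 = (t ^+ 2 * dot u u) * (s ^+ 2 * dot u u).
    by rewrite -tb ls dotZr; ring.
  by rewrite ta sa -expr2 ltxx.
have t0 : t != 0 by apply/eqP => t0; move: a0; rewrite -ta t0 expr0n mul0r ltxx.
have tt : 0 < t ^+ 2 by rewrite exprn_even_gt0.
by rewrite -(ler_pM2l tt) -exprMn tb mulrCA ta.
Qed.

End Strict.

(** * The three claims, from the bounds for the lattice and its dual *)

Theorem corollary5p4 (R : realType) (n : nat) (a b : R)
    (v : n.-tuple 'rV[R]_n)
    (a_gt0 : 0 < a)
    (ab : (2 * b <= a /\ 0 <= 2 * b) \/
          (- (n%:R * b) <= a /\ 0 <= - (n%:R * b)))
    (equi_v : equiangular_basis a b v) :
  (forall j : nat, (1 <= j <= n)%N ->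
     2^-1 * Num.sqrt ((a - b) * (a + b * (n%:R - j%:R))
                        / (a + b * (n%:R - j%:R - 1)))
       <= packing_minimum j (@unit_ball R n) (lattice_of v)
     /\
     2^-1 <= packing_minimum j (@unit_ball R n) (lattice_of v)
             * packing_minimum (n - j + 1)
                 (polar (difference_body (@unit_ball R n)))
                 (dual_lattice (lattice_of v)))
  /\
  ((2 <= n)%N -> b != 0 ->
     packing_minimum (n - 1) (@unit_ball R n) (lattice_of v)
       < packing_minimum n (@unit_ball R n) (lattice_of v)).
Proof.
have [n0|n0] := posnP n; first by split=> [j|]; lia.
have n1 : 1 <= n%:R :> R by rewrite ler1n.
case: equi_v => _ va vb.
have [ha hn] : 2 * b <= a /\ 0 <= a + n%:R * b.
  case: ab => -[h1 h2]; split=> //; [nra| |lra].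
  suff : b <= 0 by lra.
  nra.
(* The affine function a + t b is nonnegative at t = -2 and t = n and positive at t = 0, hence
   positive strictly between -2 and n. *)
have pos (t : R) : -1 <= t -> t <= n%:R - 1 -> 0 < a + t * b.
  by move=> t1 tn; have [b0|b0] := leP 0 b; nra.
have nneg (t : R) : 0 <= t -> t <= n%:R -> 0 <= a + t * b.
  by move=> t0 tn; have [b0|b0] := leP 0 b; nra.
have p0 : 0 < a - b by lra.
have q0 : 0 < a + (n%:R - 1) * b by apply: pos; lra.
have p_neq0 := lt0r_neq0 p0.
have q_neq0 := lt0r_neq0 q0.
pose w := equiangular_dual a b v.
have vw : biorthogonal v w by exact: equiangular_dualP.
have wv := biorthogonal_sym vw.
have ww := dot_equiangular_dual va vb p0 q0.
have vLam k : lattice_of v (tnth v k).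
  exists (fun l => (l == k)%:Z); rewrite (bigD1 k) //= eqxx mulr1z big1 ?addr0 //.
  by move=> l /negPf ->; rewrite mulr0z.
have Lam_int x : lattice_of v x -> forall k, dot x (tnth w k) \is a Num.int.
  move=> [c ->] k; rewrite dot_suml; apply: rpred_sum => l _.
  by rewrite -scaler_int dotZl vw rpredM ?intr_int ?intr_nat.
have wDual k : dual_lattice (lattice_of v) (tnth w k) by move=> x /Lam_int.
have Dual_int x : dual_lattice (lattice_of v) x ->
    forall k, dot x (tnth v k) \is a Num.int.
  by move=> xD k; rewrite dotC; exact: xD.
have KB : difference_body (@unit_ball R n) = ball 2.
  by rewrite (difference_body_ball n 1) mulr1.
have KD : difference_body (polar (difference_body (@unit_ball R n))) = ball 1.
  rewrite KB polar_ball // difference_body_ball.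
  by rewrite divff ?pnatr_eq0.
have part1 j : (1 <= j <= n)%N ->
    2^-1 * Num.sqrt ((a - b) * (a + b * (n%:R - j%:R))
                       / (a + b * (n%:R - j%:R - 1)))
      <= packing_minimum j (@unit_ball R n) (lattice_of v).
  move=> j1n; have /andP[j1 jn] := j1n.
  have j1R : 1 <= j%:R :> R by rewrite ler1n.
  have jnR : j%:R <= n%:R :> R by rewrite ler_nat.
  (* [A] and [B] are the Gram entries of the dual basis [w]. *)
  set A := (a - b)^-1 * (1 - b / (a + (n%:R - 1) * b)).
  set B := - ((a - b)^-1 * (b / (a + (n%:R - 1) * b))).
  have pq0 : 0 < ((a - b) * (a + (n%:R - 1) * b))^-1 by rewrite invr_gt0 mulr_gt0.
  (* Up to a positive factor, dualizing reflects t to n - 2 - t. This swaps the endpoints -2 and n,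
     whence the invariance of the assumptions. *)
  have AB (t : R) : A + t * B
      = (a + (n%:R - 2 - t) * b) * ((a - b) * (a + (n%:R - 1) * b))^-1.
    by rewrite /A /B; field; rewrite p_neq0 q_neq0.
  have r0 : 0 < a + b * (n%:R - j%:R - 1) by rewrite mulrC; apply: pos; lra.
  have := @packing_minimum_ge R n j (@unit_ball R n) (lattice_of v) 2 A B w v.
  have -> : A - B = A + (-1) * B by ring.
  rewrite !AB.
  have -> : (a + (n%:R - 2 - (j%:R - 2)) * b) *
      ((a - b) * (a + (n%:R - 1) * b))^-1 /
      ((a + (n%:R - 2 - -1) * b) * ((a - b) * (a + (n%:R - 1) * b))^-1 *
       ((a + (n%:R - 2 - (j%:R - 1)) * b) *
        ((a - b) * (a + (n%:R - 1) * b))^-1))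
      = (a - b) * (a + b * (n%:R - j%:R)) / (a + b * (n%:R - j%:R - 1)).
    by field; rewrite p_neq0 (gt_eqF r0) q_neq0.
  rewrite [2^-1 * _]mulrC; apply=> //.
  - by move=> k; rewrite ww eqxx.
  - by move=> k l kl; rewrite ww (negPf kl) /B sub0r mulrN.
  - by rewrite pmulr_lgt0 //; apply: pos; lra.
  - by rewrite pmulr_lgt0 //; apply: pos; lra.
  - rewrite -subr_ge0 -mulNr; have -> : A + - 2 * B = A + (-2) * B by ring.
    by rewrite AB pmulr_lge0 //; lra.
  by rewrite pmulr_lge0 //; nra.
split=> [j j1n|n2 b0].
  split; first exact: part1.
  have /andP[j1 jn] := j1n.
  have j1R : 1 <= j%:R :> R by rewrite ler1n.
  have jnR : j%:R <= n%:R :> R by rewrite ler_nat.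
  have := part1 j j1n.
  set d := _ / _ => le1.
  have r0 : 0 < a + b * (n%:R - j%:R - 1) by rewrite mulrC; apply: pos; lra.
  have s0 : 0 < a + b * (n%:R - j%:R) by rewrite mulrC; apply: pos; lra.
  have d0 : 0 < d by rewrite divr_gt0 ?mulr_gt0.
  have NE : (n - j + 1)%:R = n%:R - j%:R + 1 :> R by rewrite natrD natrB.
  (* Now [v] tests and [w] generates, the reverse of [part1]. The index n - j + 1 makes the radicand
     the reciprocal of [d], so only the factor 1/2 survives in the product. *)
  have := @packing_minimum_ge R n (n - j + 1)%N _ _ 1 a b v w KD ltr01 vw va vb p0.
  rewrite NE divr1.
  have -> : (a + (n%:R - j%:R + 1 - 2) * b) /
      ((a - b) * (a + (n%:R - j%:R + 1 - 1) * b)) = d^-1.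
    rewrite /d invf_div; congr (_ / _); ring.
  move=> le2.
  have {}le2 : Num.sqrt d^-1 <= packing_minimum (n - j + 1)
                 (polar (difference_body (@unit_ball R n)))
                 (dual_lattice (lattice_of v)).
    have qN : 0 < a + (n%:R - j%:R + 1 - 1) * b by apply: pos; lra.
    have rN : 0 <= a + (n%:R - j%:R + 1) * b by apply: nneg; lra.
    have N1n : (0 < n - j + 1 <= n)%N.
      by rewrite addn1 ltn_subrL j1 n0.
    exact: le2 qN ha rN Dual_int wDual N1n.
  apply: le_trans (ler_pM _ (sqrtr_ge0 _) le1 le2); last first.
    by rewrite mulr_ge0 ?sqrtr_ge0 ?invr_ge0 ?ler0n.
  by rewrite -mulrA -sqrtrM ?(ltW d0) // mulfV ?gt_eqF // sqrtr1 mulr1.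
(* At j = n the lower bound collapses to half the square root of [a]. *)
apply: lt_le_trans (part1 n _); last by rewrite n0 leqnn.
rewrite subrr mulr0 addr0 sub0r mulrN1 (mulrAC (a - b)) divff // mul1r.
apply: (packing_minimum_pred_lt KB vw vLam va vb a_gt0 _ b0 n2).
have n2R : 2 <= n%:R :> R by rewrite (ler_nat R 2 n).
have ab_gt0 : 0 < a + b by rewrite -(mul1r b); apply: pos; lra.
by rewrite -subr_gt0 subr_sqr mulr_gt0.
Qed.
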